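(* Let $T$ be a complete continuous theory in a countable continuous language, $\varphi(x,y)$ a $[0,1]$-valued formula which is $\delta$-stable in $T$, $M\models T$, and $\mu$ a Keisler measure on $S_\varphi(M)$. Then there is a countable collection $(C_i)_{i\in I}$ of pairwise disjoint closed subsets of $S_\varphi(M)$ such that (i) for all $i\in I$, $\operatorname{diam}(C_i)\leq 2\delta$ and $\mu(C_i)>0$, and (ii) $\mu=\sum_{i\in I}\alpha_i\mu_{C_i}$ where $\alpha_i=\mu(C_i)$.
   Context: $\varphi(x,y)$ is $\delta$-stable in $T$ if for every $M\models T$ there do not exist $a_i\in M^x$, $b_i\in M^y$ ($i\in\mathbb{N}$) with $|\varphi(a_i,b_j)-\varphi(a_j,b_i)|\geq\delta$ for all $i<j$. $S_\varphi(M)$ is the space of complete local $\varphi$-types over $M$ (a type $p$ is determined by the function $b\mapsto\varphi(p,b)$ on $M^y$), a compact Hausdorff space with the quotient topology from $S_x(M)$. The $d$-metric on $S_\varphi(M)$ is $d(p,q)=\sup_{b\in M^y}|\varphi(p,b)-\varphi(q,b)|$, and $\operatorname{diam}(C)=\sup\{d(p,q):p,q\in C\}$. A Keisler measure on $S_\varphi(M)$ is a regular Borel probability measure on it. For Borel $X$ with $\mu(X)>0$, $\mu_X$ is the localization $\mu_X(B)=\mu(B\cap X)/\mu(X)$. *)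

(* Defs.v *)
From HB Require Import structures.
From mathcomp Require Import all_boot all_order all_algebra.
From mathcomp Require Import all_classical all_reals all_analysis.
Set Implicit Arguments.
Unset Strict Implicit.
Unset Printing Implicit Defensive.
Import Order.TTheory GRing.Theory Num.Theory.
Import numFieldNormedType.Exports.
Local Open Scope classical_set_scope.
Local Open Scope ring_scope.
Local Open Scope quotient_scope.

(** * Many-sorted continuous first-order logic *)

(* Predicate symbols take values in [pred_min, pred_max]; [fun_mod], [pred_mod]
   are moduli of uniform continuity, for the maximum metric on the domain. *)
Record language (R : realType) := Language {
  lsort : Type ;
  ldiam : lsort -> R ;
  fun_sym : Type ;
  fun_dom : fun_sym -> seq lsort ;
  fun_cod : fun_sym -> lsort ;
  fun_mod : fun_sym -> R -> R ;
  fun_mod_gt0 : forall f e, 0 < e -> 0 < fun_mod f e ;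
  pred_sym : Type ;
  pred_dom : pred_sym -> seq lsort ;
  pred_min : pred_sym -> R ;
  pred_max : pred_sym -> R ;
  pred_mod : pred_sym -> R -> R ;
  pred_mod_gt0 : forall P e, 0 < e -> 0 < pred_mod P e
}.

Definition countable_language (R : realType) (L : language R) : Prop :=
  [/\ countable [set: lsort L], countable [set: fun_sym L]
    & countable [set: pred_sym L]].

(* [env X [:: s1; ...; sn]] is X s1 * ... * X sn * unit. *)
Fixpoint env (S : Type) (X : S -> Type) (G : seq S) : Type :=
  if G is s :: G' then (X s * env X G')%type else unit.

Fixpoint env_cat (S : Type) (X : S -> Type) (G H : seq S) :
    env X G -> env X H -> env X (G ++ H) :=
  match G with
  | [::] => fun _ b => b
  | s :: G' => fun a b => (a.1, env_cat a.2 b)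
  end.

Fixpoint env_map (S : Type) (X Y : S -> Type) (j : forall s, X s -> Y s)
    (G : seq S) : env X G -> env Y G :=
  match G with
  | [::] => fun _ => tt
  | s :: G' => fun a => (j s a.1, env_map j a.2)
  end.

(* Coordinatewise relation, used for "every coordinate is at distance < r". *)
Fixpoint env_all2 (S : Type) (X : S -> Type) (r : forall s, X s -> X s -> Prop)
    (G : seq S) : env X G -> env X G -> Prop :=
  match G with
  | [::] => fun _ _ => True
  | s :: G' => fun a b => r s a.1 b.1 /\ env_all2 r a.2 b.2
  end.

Record structure (R : realType) (L : language R) := Structure {
  carrier : lsort L -> metricType R ;
  carrier_nonempty : forall s, inhabited (carrier s) ;
  carrier_complete : forall s (F : set_system (carrier s)),
    ProperFilter F -> cauchy F -> exists a : carrier s, F --> a ;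
  carrier_diam : forall s (a b : carrier s), mdist a b <= ldiam s ;
  finterp : forall f : fun_sym L,
    env carrier (fun_dom f) -> carrier (fun_cod f) ;
  finterp_unif : forall f e (a b : env carrier (fun_dom f)), 0 < e ->
    env_all2 (fun s (u v : carrier s) => mdist u v < fun_mod f e) a b ->
    mdist (finterp a) (finterp b) <= e ;
  pinterp : forall P : pred_sym L, env carrier (pred_dom P) -> R ;
  pinterp_bounds : forall P (a : env carrier (pred_dom P)),
    pred_min P <= pinterp a <= pred_max P ;
  pinterp_unif : forall P e (a b : env carrier (pred_dom P)), 0 < e ->
    env_all2 (fun s (u v : carrier s) => mdist u v < pred_mod P e) a b ->
    `|pinterp a - pinterp b| <= e
}.

(* M^x, for a tuple of variables of sorts x. *)
Definition tuples (R : realType) (L : language R) (M : structure L)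
    (x : seq (lsort L)) : Type :=
  env (fun s => carrier M s : Type) x.

(* Variables are typed de Bruijn indices: a term or formula over the context G
   has its free variables among a tuple of variables of sorts G. *)
Inductive var (S : Type) : seq S -> S -> Type :=
| VHere G s : var (s :: G) s
| VThere G s t : var G s -> var (t :: G) s.

Fixpoint lookup (S : Type) (X : S -> Type) (G : seq S) (s : S) (v : var G s) :
    env X G -> X s :=
  match v in var G s return env X G -> X s with
  | VHere _ _ => fun e => e.1
  | VThere _ _ _ v' => fun e => lookup v' e.2
  end.

Inductive term (R : realType) (L : language R) (G : seq (lsort L)) :
    lsort L -> Type :=
| TVar s : var G s -> term G s
| TApp f : terms G (fun_dom f) -> term G (fun_cod f)
with terms (R : realType) (L : language R) (G : seq (lsort L)) :
    seq (lsort L) -> Type :=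
| TNil : terms G [::]
| TCons s H : term G s -> terms G H -> terms G (s :: H).

(* All continuous u : R^n -> R are connectives. *)
Inductive formula (R : realType) (L : language R) : seq (lsort L) -> Type :=
| FDist G s : term G s -> term G s -> formula G
| FPred G P : terms G (pred_dom P) -> formula G
| FConn G n (u : 'rV[R]_n -> R) :
    continuous u -> ('I_n -> formula G) -> formula G
| FSup G s : formula (s :: G) -> formula G
| FInf G s : formula (s :: G) -> formula G.

Section Semantics.
Context (R : realType) (L : language R) (M : structure L).

Fixpoint teval (G : seq (lsort L)) (s : lsort L) (t : term G s)
    (e : tuples M G) {struct t} : carrier M s :=
  match t in term _ s return carrier M s with
  | TVar _ v => lookup v e
  | TApp f ts => finterp (tseval ts e)
  end
with tseval (G H : seq (lsort L)) (ts : terms G H)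
    (e : tuples M G) {struct ts} : tuples M H :=
  match ts in terms _ H return tuples M H with
  | TNil => tt
  | TCons _ _ t ts' => (teval t e, tseval ts' e)
  end.

Fixpoint feval (G : seq (lsort L)) (phi : formula G) : tuples M G -> R :=
  match phi in formula G return tuples M G -> R with
  | FDist _ _ t1 t2 => fun e => mdist (teval t1 e) (teval t2 e)
  | FPred _ P ts => fun e => pinterp (tseval ts e)
  | FConn _ _ u _ args => fun e => u (\row_i feval (args i) e)
  | FSup _ s psi => fun e =>
      sup [set feval psi ((a, e) : tuples M (s :: _)) | a in [set: carrier M s]]
  | FInf _ s psi => fun e =>
      inf [set feval psi ((a, e) : tuples M (s :: _)) | a in [set: carrier M s]]
  end.

(* phi(a, b), for a formula phi(x, y). *)
Definition feval2 (x y : seq (lsort L)) (phi : formula (x ++ y))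
    (a : tuples M x) (b : tuples M y) : R :=
  feval phi (env_cat a b).

End Semantics.

Definition sentence (R : realType) (L : language R) : Type := @formula R L [::].

(* A sentence sigma in T stands for the closed condition sigma = 0. *)
Definition theory (R : realType) (L : language R) : Type := set (sentence L).

Definition models (R : realType) (L : language R) (M : structure L)
    (T : theory L) : Prop :=
  forall sigma, T sigma -> feval (M := M) sigma tt = 0.

Definition complete_theory (R : realType) (L : language R) (T : theory L) :
    Prop :=
  (exists M : structure L, models M T) /\
  (forall sigma : sentence L, exists r : R,
     forall M : structure L, models M T -> feval (M := M) sigma tt = r).

Definition unit_valued (R : realType) (L : language R) (T : theory L)
    (G : seq (lsort L)) (phi : formula G) : Prop :=
  forall M : structure L, models M T ->
  forall e : tuples M G, 0 <= feval phi e <= 1.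

Definition stable (R : realType) (L : language R) (T : theory L)
    (x y : seq (lsort L)) (phi : formula (x ++ y)) (delta : R) : Prop :=
  forall M : structure L, models M T ->
  ~ exists (a : nat -> tuples M x) (b : nat -> tuples M y),
      forall i j : nat, (i < j)%N ->
        delta <= `|feval2 phi (a i) (b j) - feval2 phi (a j) (b i)|.

(** * Type spaces *)

Definition elementary (R : realType) (L : language R) (M N : structure L)
    (j : forall s, carrier M s -> carrier N s) : Prop :=
  forall (G : seq (lsort L)) (theta : formula G) (e : tuples M G),
    feval (M := N) theta (env_map j e) = feval theta e.

(* Formulas theta(x, m) in the free variables x with parameters m from M. *)
Record pformula (R : realType) (L : language R) (M : structure L)
    (x : seq (lsort L)) := PFormula {
  pctx : seq (lsort L) ;
  pform : formula (x ++ pctx) ;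
  pparam : tuples M pctx
}.

HB.instance Definition _ (R : realType) (L : language R) (M : structure L)
  (x : seq (lsort L)) := gen_eqMixin (pformula M x).
HB.instance Definition _ (R : realType) (L : language R) (M : structure L)
  (x : seq (lsort L)) := gen_choiceMixin (pformula M x).

Section TypeSpace.
Context (R : realType) (L : language R) (M : structure L) (x : seq (lsort L)).

(* p = tp(a / M) for a tuple a in an elementary extension of M; a type is
   identified with the map theta(x, m) |-> theta(p, m). *)
Definition is_complete_type (p : pformula M x -> R) : Prop :=
  exists (N : structure L) (j : forall s, carrier M s -> carrier N s)
         (a : tuples N x),
    elementary j /\
    forall theta : pformula M x,
      p theta = feval2 (pform theta) a (env_map j (pparam theta) : tuples N _).

Definition type_space : Type := {p : pformula M x -> R | is_complete_type p}.

Definition type_val (p : type_space) : {ptws pformula M x -> R} := sval p.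

HB.instance Definition _ := gen_eqMixin type_space.
HB.instance Definition _ := gen_choiceMixin type_space.

(* The logic topology: the coarsest one making all p |-> theta(p, m)
   continuous. *)
HB.instance Definition _ :=
  Topological.copy type_space (initial_topology type_val).

Lemma env_map_id (S : Type) (X : S -> Type) (G : seq S) (e : env X G) :
  env_map (fun _ u => u) e = e.
Proof. by elim: G e => [|s G IH] /= => [[]|[u e]] //=; rewrite IH. Qed.

Lemma tuples_inhabited : inhabited (tuples M x).
Proof.
elim: x => [|s G [e]]; first exact: inhabits tt.
by have [u] := carrier_nonempty M s; exact: inhabits (u, e).
Qed.

Lemma type_space_inhabited : inhabited type_space.
Proof.
have [a] := tuples_inhabited.
suff H : is_complete_type (fun theta => feval2 (pform theta) a (pparam theta)).
  exact: inhabits (exist _ _ H).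
exists M, (fun _ u => u), a; split=> [G theta e|theta];
  by rewrite env_map_id.
Qed.

HB.instance Definition _ :=
  isPointed.Build type_space (inhabited_witness type_space_inhabited).

End TypeSpace.

Section LocalTypeSpace.
Context (R : realType) (L : language R) (M : structure L).
Context (x y : seq (lsort L)) (phi : formula (x ++ y)).

Definition phi_val (p : type_space M x) (b : tuples M y) : R :=
  type_val p (@PFormula R L M x y phi b).

Definition phi_equiv (p q : type_space M x) : bool :=
  `[< forall b : tuples M y, phi_val p b = phi_val q b >].

Lemma phi_equiv_is_equiv : equiv_class_of phi_equiv.
Proof.
split=> [p|p q|q p r].
- exact/asboolP.
- by apply/asboolP/asboolP => H b; rewrite H.
- by move=> /asboolP H /asboolP K; apply/asboolP => b; rewrite H K.
Qed.

Canonical phi_equiv_rel := EquivRelPack phi_equiv_is_equiv.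

(* S_phi(M), with the quotient topology from S_x(M). *)
Definition local_type_space : Type :=
  quotient_topology {eq_quot phi_equiv_rel}.

HB.instance Definition _ := PointedTopological.on local_type_space.

(* phi(p, b), for a local type p. *)
Definition local_val (p : local_type_space) (b : tuples M y) : R :=
  phi_val (repr p) b.

Definition local_dist (p q : local_type_space) : \bar R :=
  ereal_sup [set `|local_val p b - local_val q b|%:E | b in [set: tuples M y]].

Definition local_diam (C : set local_type_space) : \bar R :=
  ereal_sup [set local_dist pq.1 pq.2 | pq in C `*` C].

End LocalTypeSpace.

(** * Borel measures *)

Definition borel (X : ptopologicalType) := g_sigma_algebraType (@open X).

Definition regular_measure (R : realType) (X : ptopologicalType)
    (mu : set (borel X) -> \bar R) : Prop :=
  forall B : set (borel X), measurable B ->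
    mu B = ereal_inf [set mu U | U in [set U : set X | open U /\ B `<=` U]] /\
    mu B = ereal_sup [set mu K | K in [set K : set X | compact K /\ K `<=` B]].

(* Only meaningful when 0 < mu X < +oo. *)
Definition localization (R : realType) (T : Type) (mu : set T -> \bar R)
    (X : set T) : set T -> \bar R :=
  fun B => (mu (B `&` X) * ((fine (mu X))^-1)%:E)%E.

(* Main.v *)
(* A set of positive measure contains, by inner regularity, the support S of
   the restriction of mu to some compact set, so it suffices to find in every
   nonempty set S of local types a nonempty relatively open piece of diameter
   at most 2 delta; greedily removing closed pieces then exhausts mu.

   An ultrapower of M upgrades delta-stability to gamma-stability inside M for
   some gamma < delta.  Suppose that S has no small relatively open piece.  Given
   finitely many a's in M, colour M^y by the approximate values of phi(a, -).
   If on some relatively open piece every type oscillated by at most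
   gamma + delta on each colour, then shrinking the piece, one colour at a time,
   to types that nearly reach the supremum of the colour would make it small.
   So some b, b' of the same colour satisfy p(b) - p(b') > gamma + delta on an
   open piece, and a new a in M approximating a type there continues the
   construction.  By Ramsey's theorem, along a subsequence of the resulting
   sequence either the b or the b' violate gamma-stability. *)
Require Import Defs.
From HB Require Import structures.
From mathcomp Require Import all_boot all_order all_algebra.
From mathcomp Require Import all_classical all_reals all_analysis.
From mathcomp Require Import ring lra.
Set Implicit Arguments.
Unset Strict Implicit.
Unset Printing Implicit Defensive.
Import Order.TTheory GRing.Theory Num.Theory.
Import numFieldNormedType.Exports.
Local Open Scope classical_set_scope.
Local Open Scope ring_scope.
Local Open Scope quotient_scope.

(** * Ultralimits *)

Section UltraLimits.
Context (R : realType) (I : Type) (U : set_system I) {UU : UltraFilter U}.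
Implicit Types (u v : I -> R) (l m r : R).

#[local] Instance ultra_proper_filter : ProperFilter U := ultra_proper.

(** The pushforward of [U] along [u] is an ultrafilter on a compact segment, so it converges. Hence
    the [lim] of a bounded sequence along [U] is a genuine limit. *)
Lemma ultra_bounded_cvg u (B : R) : (forall k, `|u k| <= B) ->
  u @ U --> lim (u @ U).
Proof.
move=> uB; have : compact `[- B, B]%classic by exact: segment_compact.
rewrite compact_ultra => /(_ [set A | exists2 S, U S & u @` S `<=` A]) [].
- have UuF : UltraFilter (u @ U).
    split=> [|G GF uG]; first exact: fmap_proper_filter.
    apply/seteqP; split=> A; last exact: uG.
    move=> GA; have [//|/= UnA] := in_ultra_setVsetC (u @^-1` A) UU.
    have /uG GnA : (u @ U) (~` A) by [].
    by have := filter_ex (filterI GA GnA) => -[z []].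
  suff -> : [set A | exists2 S, U S & u @` S `<=` A] = u @ U by [].
  apply/seteqP; split=> A /=.
    by move=> [S US uS]; apply: filterS US => k Sk; apply: uS; exists k.
  by move=> UA; exists (u @^-1` A) => // _ [k ? <-].
- exists setT; first exact: filterT.
  by move=> _ [k _ <-] /=; rewrite in_itv/= -ler_norml.
move=> l [_ /= ul]; apply/cvg_ex; exists l => A /ul [S US uS].
by apply: (filterS _ US : U (u @^-1` A)) => k Sk; apply: uS; exists k.
Qed.

Lemma ultra_lim_bounded u (B : R) l : (forall k, `|u k| <= B) ->
  u @ U --> l -> `|l| <= B.
Proof.
move=> uB ul; rewrite ler_norml; apply/andP; split.
  apply: (cvgr_to_ge ul); apply: nearW => k.
  by have := uB k; rewrite ler_norml => /andP[].
apply: (cvgr_to_le ul); apply: nearW => k.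
by have := uB k; rewrite ler_norml => /andP[].
Qed.

Lemma ultra_cvg_le u v l m : u @ U --> l -> v @ U --> m ->
  (\forall k \near U, u k <= v k) -> l <= m.
Proof.
move=> ul vm uv; rewrite -subr_ge0.
apply: (cvgr_to_ge (cvgB vm ul)); apply: filterS uv => k.
by rewrite /= subr_ge0.
Qed.

Lemma ultra_cvg_dist_le u v l m r : u @ U --> l -> v @ U --> m ->
  (\forall k \near U, `|u k - v k| <= r) -> `|l - m| <= r.
Proof.
move=> ul vm uv; apply: (@cvgr_to_le _ _ _ _ (fun k => `|u k - v k|)) uv.
by apply: cvg_norm; exact: cvgB.
Qed.

Lemma ultra_cvg_unique u l m : u @ U --> l -> u @ U --> m -> l = m.
Proof.
move=> ul um; apply/eqP; rewrite eq_le.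
by rewrite (ultra_cvg_le ul um) ?(ultra_cvg_le um ul)//; exact: nearW.
Qed.

(** The competitors on the limit side are whole sequences [a : I -> X], so near-maximizers chosen
    separately at each index form a single competitor. This is the quantifier step of the theorem of
    Los. *)
Lemma ultra_cvg_sup (X : Type) (g : I -> X -> R) (B : R)
    (h : (I -> X) -> R) : inhabited X ->
  (forall k a, `|g k a| <= B) ->
  (forall a : I -> X, (fun k => g k (a k)) @ U --> h a) ->
  (fun k => sup (range (g k))) @ U --> sup (range h).
Proof.
move=> [x0] gB gh.
have gub k : has_sup (range (g k)).
  split; first by exists (g k x0), x0.
  by exists B => _ [a _ <-]; exact: le_trans (ler_norm _) (gB k a).
have hB a : `|h a| <= B by exact: ultra_lim_bounded (gh a).
have hub : has_sup (range h).
  split; first by exists (h (fun=> x0)), (fun=> x0).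
  by exists B => _ [a _ <-]; exact: le_trans (ler_norm _) (hB a).
have sB k : `|sup (range (g k))| <= B.
  rewrite ler_norml; apply/andP; split.
    apply: (@le_trans _ _ (g k x0)).
      by have := gB k x0; rewrite ler_norml => /andP[].
    by apply: ub_le_sup; [case: (gub k)|exists x0].
  apply: ge_sup; first by case: (gub k).
  by move=> _ [a _ <-]; exact: le_trans (ler_norm _) (gB k a).
have sl := ultra_bounded_cvg sB; set l := lim _ in sl.
suff -> : sup (range h) = l by [].
apply/eqP; rewrite eq_le; apply/andP; split.
  apply: ge_sup; first by case: hub.
  move=> _ [a _ <-]; apply: ultra_cvg_le (gh a) sl _.
  by apply: nearW => k; apply: ub_le_sup; [case: (gub k)|exists (a k)].
apply/ler_addgt0Pr => e e0.
have /choice[a ga] k : exists a, sup (range (g k)) - e < g k a.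
  by have [_ [a _ <-]] := sup_adherent e0 (gub k); exists a.
rewrite -lerBlDr; apply: (@le_trans _ _ (h a)).
  apply: (@ultra_cvg_le (fun k => sup (range (g k)) - e) _ _ _ _ (gh a)).
    by apply: cvgB => //; exact: cvg_cst.
  by apply: nearW => k; exact: ltW.
by apply: ub_le_sup; [case: hub|exists a].
Qed.

Lemma ultra_cvg_inf (X : Type) (g : I -> X -> R) (B : R)
    (h : (I -> X) -> R) : inhabited X ->
  (forall k a, `|g k a| <= B) ->
  (forall a : I -> X, (fun k => g k (a k)) @ U --> h a) ->
  (fun k => inf (range (g k))) @ U --> inf (range h).
Proof.
move=> X0 gB gh.
have infE (Y : Type) (f : Y -> R) : inf (range f) = - sup (range (fun a => - f a)).
  by rewrite /inf image_comp.
rewrite infE (_ : (fun k => inf _) = (fun k => - sup (range (fun a => - g k a)))).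
  apply: cvgN; apply: (@ultra_cvg_sup X _ B) => // [k a|a]; first by rewrite normrN.
  exact: cvgN.
by apply/funext => k; rewrite infE.
Qed.

End UltraLimits.

Scheme term_mutind := Induction for term Sort Prop
with terms_mutind := Induction for terms Sort Prop.
Combined Scheme term_terms_ind from term_mutind, terms_mutind.

Lemma norm_pinterp_le (R : realType) (L : language R) (M : structure L)
    (P : pred_sym L) (a : tuples M (pred_dom P)) :
  `|pinterp a| <= Num.max `|pred_min P| `|pred_max P|.
Proof.
have /andP[h1 h2] := pinterp_bounds a.
rewrite ler_norml lerNl !le_max; apply/andP; split.
  by rewrite -normrN (le_trans _ (ler_norm _)) ?lerN2.
by rewrite (le_trans h2 (ler_norm _)) orbT.
Qed.

(** At a connective the arguments range over a compact box, on which the continuous [u] is bounded.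
    The bound keeps the [sup] and [inf] of quantifiers away from their default values. *)
Lemma feval_bounded (R : realType) (L : language R) (M : structure L)
    (G : seq (lsort L)) (theta : formula G) :
  exists B, forall e : tuples M G, `|feval theta e| <= B.
Proof.
have sup_bound (X : Type) (f : X -> R) B : inhabited X ->
    (forall a, `|f a| <= B) -> `|sup (range f)| <= B.
  move=> [x0] fB; rewrite ler_norml; apply/andP; split.
    apply: (@le_trans _ _ (f x0)).
      by have := fB x0; rewrite ler_norml => /andP[].
    apply: ub_le_sup; last by exists x0.
    by exists B => _ [a _ <-]; exact: le_trans (ler_norm _) (fB a).
  apply: ge_sup; first by exists (f x0), x0.
  by move=> _ [a _ <-]; exact: le_trans (ler_norm _) (fB a).
elim: theta => {G} [G s t1 t2|G P ts|G n u uc args IH|G s psi [B IH]|G s psi [B IH]].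
- by exists (ldiam s) => e /=; rewrite ger0_norm ?mdist_ge0// carrier_diam.
- exists (Num.max `|pred_min P| `|pred_max P|) => e /=.
  exact: norm_pinterp_le.
- have /choice[B HB] := IH.
  have cpt : compact [set v : 'rV[R]_n |
      forall i, [set` `[- B i, B i]] (v ord0 i)].
    apply: (@rV_compact R n (fun i => [set` `[- B i, B i]])) => i.
    exact: segment_compact.
  have /compact_bounded : compact (u @` [set v : 'rV[R]_n |
      forall i, [set` `[- B i, B i]] (v ord0 i)]).
    by apply: continuous_compact => //; exact: continuous_subspaceT.
  move=> [C [_ HC]]; exists (C + 1) => e /=.
  apply: (HC (C + 1)); first by rewrite ltrDl.
  eexists; last by [].
  by move=> i /=; rewrite mxE in_itv/= -ler_norml.
- exists B => e /=; apply: sup_bound => [|a]; last exact: IH.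
  exact: carrier_nonempty.
- exists B => e /=; rewrite /inf normrN image_comp.
  apply: (@sup_bound _ _ B) => [|a].
    exact: carrier_nonempty.
  by rewrite /= normrN; exact: IH.
Qed.

(** * Ultrapowers of metric structures *)

Section Ultrapower.
Context (R : realType) (L : language R) (M : structure L).
Context (U : set_system nat) {UU : UltraFilter U}.

#[local] Instance ultrapower_proper : ProperFilter U := ultra_proper.

Section Carrier.
Context (s : lsort L).
Implicit Types f g h : nat -> carrier M s.

(** Only a pseudometric on sequences; [ueq] divides out distance zero. *)
Definition udist f g : R := lim ((fun k => mdist (f k) (g k)) @ U).

Lemma cvg_udist f g : (fun k => mdist (f k) (g k)) @ U --> udist f g.
Proof.
apply: (@ultra_bounded_cvg _ _ _ _ _ (ldiam s)) => k.
by rewrite ger0_norm ?mdist_ge0 ?carrier_diam.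
Qed.

Arguments cvg_udist : clear implicits.

Lemma udist_eqP f g (r : R) :
  (fun k => mdist (f k) (g k)) @ U --> r -> udist f g = r.
Proof. by move=> fgr; apply: ultra_cvg_unique fgr; exact: cvg_udist. Qed.

Lemma udistxx f : udist f f = 0.
Proof.
apply: udist_eqP; rewrite (_ : (fun k => _) = fun=> 0); first exact: cvg_cst.
by apply/funext => k; rewrite mdistxx.
Qed.

Lemma udistC f g : udist f g = udist g f.
Proof.
apply: udist_eqP; rewrite (_ : (fun k => _) = fun k => mdist (g k) (f k)).
  exact: cvg_udist.
by apply/funext => k; rewrite metric_sym.
Qed.

Lemma udist_triangle g f h : udist f h <= udist f g + udist g h.
Proof.
refine (ultra_cvg_le (cvg_udist f h) (cvgD (cvg_udist f g) (cvg_udist g h)) _).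
by apply: nearW => k; exact: metric_triangle.
Qed.

Lemma udist_ge0 f g : 0 <= udist f g.
Proof.
apply: (cvgr_to_ge (cvg_udist f g)).
by apply: nearW => k; exact: mdist_ge0.
Qed.

Definition ueq f g : bool := `[< udist f g = 0 >].

Lemma ueq_is_equiv : equiv_class_of ueq.
Proof.
split=> [f|f g|f g h].
- exact/asboolP/udistxx.
- by rewrite /ueq udistC.
- move=> /asboolP gf /asboolP fh; apply/asboolP/eqP.
  rewrite eq_le udist_ge0 andbT.
  by have := udist_triangle f g h; rewrite gf fh addr0.
Qed.

Canonical ueq_rel := EquivRelPack ueq_is_equiv.

Definition upow : Type := {eq_quot ueq_rel}.

HB.instance Definition _ := gen_eqMixin upow.
HB.instance Definition _ := gen_choiceMixin upow.

Definition ucls f : upow := \pi_({eq_quot ueq_rel}) f.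
Definition urepr (x : upow) : nat -> carrier M s :=
  repr (x : {eq_quot ueq_rel}).

Lemma ureprK x : ucls (urepr x) = x.
Proof. exact: (@reprK _ {eq_quot ueq_rel}). Qed.

Lemma ucls_eqP f g : ucls f = ucls g <-> udist f g = 0.
Proof.
split; first by move/eqmodP/asboolP.
by move=> fg; apply/eqmodP/asboolP.
Qed.

Lemma udist_urepr f g : udist (urepr (ucls f)) (urepr (ucls g)) = udist f g.
Proof.
have E k : udist (urepr (ucls k)) k = 0 by apply/ucls_eqP; rewrite ureprK.
apply/eqP; rewrite eq_le; apply/andP; split.
  apply: le_trans (udist_triangle f _ _) _; rewrite E add0r.
  apply: le_trans (udist_triangle g _ _) _.
  by rewrite [udist g _]udistC E addr0.
apply: le_trans (udist_triangle (urepr (ucls f)) _ _) _.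
rewrite [udist f _]udistC E add0r.
by apply: le_trans (udist_triangle (urepr (ucls g)) _ _) _; rewrite E addr0.
Qed.

Definition upow_dist (x y : upow) : R := udist (urepr x) (urepr y).

Fact upow_distxx x : upow_dist x x = 0. Proof. exact: udistxx. Qed.

Fact upow_dist_positivity x y : upow_dist x y = 0 -> x = y.
Proof. by move=> xy; rewrite -(ureprK x) -(ureprK y); exact/ucls_eqP. Qed.

Fact upow_distC x y : upow_dist x y = upow_dist y x.
Proof. exact: udistC. Qed.

Fact upow_dist_triangle y x z : upow_dist x z <= upow_dist x y + upow_dist y z.
Proof. exact: udist_triangle. Qed.

HB.instance Definition _ := isMetric.Build R upow
  upow_distxx upow_dist_positivity upow_distC upow_dist_triangle.

Lemma mdist_ucls f g : mdist (ucls f) (ucls g) = udist f g.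
Proof. exact: udist_urepr. Qed.

End Carrier.
Arguments cvg_udist {s} f g.

Definition ucarrier (s : lsort L) : metricType R := upow s.

(** A sequence of tuples is stored as a tuple of sequences, so that its terms and its class in the
    ultrapower are both coordinatewise images. *)
Definition env_at (G : seq (lsort L)) (k : nat) :
    env (fun s => nat -> carrier M s) G -> tuples M G :=
  fun e => env_map (fun s (f : nat -> carrier M s) => f k) e.

Definition env_cls (G : seq (lsort L)) :
    env (fun s => nat -> carrier M s) G -> env (fun s => ucarrier s : Type) G :=
  fun e => env_map (fun s (f : nat -> carrier M s) => ucls f) e.

Definition env_repr (G : seq (lsort L)) :
    env (fun s => ucarrier s : Type) G -> env (fun s => nat -> carrier M s) G :=
  fun e => env_map (fun s (x : ucarrier s) => urepr x) e.

Lemma env_reprK G : cancel (@env_repr G) (@env_cls G).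
Proof.
rewrite /env_repr /env_cls; elim: G => [[]|s G IH [a e]] //=.
by rewrite ureprK IH.
Qed.

(** A strict bound on an ultralimit holds at [U]-almost every index, and only finitely many
    coordinates are involved. Moduli of uniform continuity thus pass from [M] to the ultrapower. *)
Lemma near_env_at (G : seq (lsort L)) (r : R)
    (e e' : env (fun s => nat -> carrier M s) G) :
  env_all2 (fun s (u v : ucarrier s) => mdist u v < r) (env_cls e) (env_cls e') ->
  \forall k \near U, env_all2 (fun s (u v : carrier M s) => mdist u v < r)
    (env_at k e) (env_at k e').
Proof.
rewrite /env_cls /env_at.
elim: G e e' => [|s G IH] /=; first by move=> *; exact: nearW.
move=> [f e] [g e'] /= [fg /IH ee']; apply: filterI => //.
rewrite mdist_ucls in fg; have := cvg_udist f g.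
by move=> /cvgr_lt; exact.
Qed.

Lemma env_cls_eq (G : seq (lsort L)) (r : R)
    (e e' : env (fun s => nat -> carrier M s) G) : 0 < r ->
  env_cls e = env_cls e' ->
  env_all2 (fun s (u v : ucarrier s) => mdist u v < r) (env_cls e) (env_cls e').
Proof.
move=> r0; rewrite /env_cls; elim: G e e' => [|s G IH] //=.
move=> [f e] [g e'] /= [fg /IH ee'].
by split=> //; rewrite fg mdistxx.
Qed.

(** Computed on chosen representatives; uniform continuity makes the choice irrelevant, which is
    [ufinterp_cls]. *)
Definition ufinterp (f : fun_sym L)
    (a : env (fun s => ucarrier s : Type) (fun_dom f)) : ucarrier (fun_cod f) :=
  ucls (fun k => finterp (env_at k (env_repr a))).

Definition upinterp (P : pred_sym L)
    (a : env (fun s => ucarrier s : Type) (pred_dom P)) : R :=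
  lim ((fun k => pinterp (env_at k (env_repr a))) @ U).

Lemma udist_le (s : lsort L) (f g : nat -> carrier M s) (r : R) :
  (\forall k \near U, mdist (f k) (g k) <= r) -> udist f g <= r.
Proof. exact: (cvgr_to_le (cvg_udist f g)). Qed.

Lemma ufinterp_cls f e :
  @ufinterp f (env_cls e) = ucls (fun k => finterp (env_at k e)).
Proof.
apply/ucls_eqP/eqP; rewrite eq_le udist_ge0 andbT.
apply/ler_addgt0Pr => eps eps0; rewrite add0r; apply: udist_le.
have /near_env_at := env_cls_eq (fun_mod_gt0 f eps0) (env_reprK (env_cls e)).
by apply: filterS => k; exact: finterp_unif.
Qed.

Lemma cvg_pinterp P (e : env (fun s => nat -> carrier M s) (pred_dom P)) :
  (fun k => pinterp (env_at k e)) @ U --> upinterp (env_cls e).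
Proof.
have cvgP (e0 : env (fun s => nat -> carrier M s) (pred_dom P)) :
    cvg ((fun k => pinterp (env_at k e0) : R) @ U).
  by apply: (ultra_bounded_cvg (fun k => @norm_pinterp_le _ _ _ P (env_at k e0))).
suff -> : upinterp (env_cls e) = lim ((fun k => pinterp (env_at k e)) @ U).
  exact: cvgP.
apply/eqP; rewrite -subr_eq0 -normr_le0; apply/ler_addgt0Pr => eps eps0.
rewrite add0r.
apply: (ultra_cvg_dist_le (cvgP (env_repr (env_cls e))) (cvgP e)).
have /near_env_at := env_cls_eq (pred_mod_gt0 P eps0) (env_reprK (env_cls e)).
by apply: filterS => k; exact: pinterp_unif.
Qed.

Arguments cvg_pinterp {P} e.

Lemma ufinterp_unif f eps (a b : env (fun s => ucarrier s : Type) (fun_dom f)) :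
  0 < eps ->
  env_all2 (fun s (u v : ucarrier s) => mdist u v < fun_mod f eps) a b ->
  mdist (ufinterp a) (ufinterp b) <= eps.
Proof.
move=> eps0; rewrite -(env_reprK a) -(env_reprK b) => /near_env_at ab.
rewrite !ufinterp_cls mdist_ucls; apply: udist_le.
by apply: filterS ab => k; exact: finterp_unif.
Qed.

Lemma upinterp_unif P eps (a b : env (fun s => ucarrier s : Type) (pred_dom P)) :
  0 < eps ->
  env_all2 (fun s (u v : ucarrier s) => mdist u v < pred_mod P eps) a b ->
  `|upinterp a - upinterp b| <= eps.
Proof.
move=> eps0; rewrite -(env_reprK a) -(env_reprK b) => /near_env_at ab.
apply: (ultra_cvg_dist_le (cvg_pinterp (env_repr a)) (cvg_pinterp (env_repr b))).
by apply: filterS ab => k; exact: pinterp_unif.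
Qed.

Lemma upinterp_bounds P (a : env (fun s => ucarrier s : Type) (pred_dom P)) :
  pred_min P <= upinterp a <= pred_max P.
Proof.
rewrite -(env_reprK a); have c := cvg_pinterp (env_repr a).
apply/andP; split; [apply: (cvgr_to_ge c)|apply: (cvgr_to_le c)];
  by apply: nearW => k; case/andP: (pinterp_bounds (env_at k (env_repr a))).
Qed.

Lemma ucarrier_nonempty s : inhabited (ucarrier s).
Proof. by have [a] := carrier_nonempty M s; exact: inhabits (ucls (fun=> a)). Qed.

Lemma ucarrier_diam s (a b : ucarrier s) : mdist a b <= ldiam s.
Proof.
rewrite -(ureprK a) -(ureprK b) mdist_ucls; apply: udist_le.
by apply: nearW => k; exact: carrier_diam.
Qed.

Hypothesis U_free : forall n : nat, U [set k | (n <= k)%N].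

(** Centres [x n] of balls of radius [d n] belonging to the filter are represented by sequences,
    which are diagonalized into one sequence [g]. Since [U] is free, almost every index lies beyond
    any given [n]. *)
Lemma ucarrier_complete s (F : set_system (ucarrier s)) :
  ProperFilter F -> cauchy F -> exists a : ucarrier s, F --> a.
Proof.
move=> FF /cauchyP Fc.
pose d n : R := n.+1%:R^-1.
have d0 n : 0 < d n by rewrite invr_gt0.
have /choice[x Fx] n : exists x, F (ball x (d n)) by exact: Fc.
pose f n := urepr (x n).
have xx i j : udist (f i) (f j) < d i + d j.
  have [z [xz yz]] := filter_ex (filterI (Fx i) (Fx j)).
  rewrite -mdist_ucls !ureprK; apply: le_lt_trans (metric_triangle _ z _) _.
  by rewrite ltrD// ?[mdist z _]metric_sym; move: xz yz; rewrite !ballEmdist.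
pose good k n := forall i j : 'I_n.+1, mdist (f i k) (f j k) <= d i + d j.
(* Each ultralimit [udist (f i) (f j)] is strictly below [d i + d j], and only finitely many pairs
   occur. *)
have Ugood n : U [set k | good k n].
  apply: filter_forall => i; apply: filter_forall => j.
  by have /cvgr_le := cvg_udist (f i) (f j); exact.
(* Index [k] follows the longest initial segment of the sequence that is
   Cauchy at [k] with the prescribed rate. *)
have /choice[g gP] k : exists a, forall n, (n <= k)%N -> good k n ->
    mdist a (f n k) <= d n + d n.
  have ex : exists n, (n <= k)%N && `[< good k n >].
    exists 0%N; apply/andP; split=> //; apply/asboolP => i j.
    by rewrite !ord1 mdistxx addr_ge0// ltW.
  have le n : (n <= k)%N && `[< good k n >] -> (n <= k)%N by case/andP.
  case: (ex_maxnP ex le) => m /andP[mk /asboolP gm] mmax.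
  exists (f m k) => n nk gn.
  have nm : (n <= m)%N by apply: mmax; rewrite nk; exact/asboolP.
  apply: le_trans (gm (Ordinal (ltnSn m)) (@Ordinal m.+1 n nm)) _.
  by rewrite lerD2r lef_pV2 ?posrE// ler_nat.
exists (ucls g); apply/metricType_numDomainType.fcvgrPdist_lt => eps eps0.
(* The limit is within [2 * d n] of [x n], and the ball around [x n] adds another [d n]. *)
have [n nP] : exists n, d n < eps / 3.
  have := near_infty_natSinv_lt (PosNum (divr_gt0 eps0 (ltr0n R 3))) => -[n _ nP].
  by exists n; exact: (nP n (leqnn n)).
apply: filterS (Fx n) => y; rewrite ballEmdist/= => xy.
apply: le_lt_trans (metric_triangle _ (x n) _) _.
apply: (@le_lt_trans _ _ ((d n + d n) + mdist (x n) y)).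
  rewrite lerD2r -[x n]ureprK mdist_ucls; apply: udist_le.
  apply: filterS (filterI (U_free n) (Ugood n)) => k [nk gk]; exact: gP.
rewrite -[eps](_ : (eps / 3 + eps / 3) + eps / 3 = eps); last by field.
by rewrite ?ltrD ?(lt_trans xy).
Qed.

Definition ultrapower : structure L := Structure ucarrier_nonempty
  ucarrier_complete ucarrier_diam ufinterp_unif upinterp_bounds upinterp_unif.

End Ultrapower.
Arguments cvg_udist {R L M U UU s} f g.
Arguments cvg_pinterp {R L M U UU P} e.

(** * The theorem of Los for continuous formulas *)

Section Los.
Context (R : realType) (L : language R) (M : structure L).
Context (U : set_system nat) {UU : UltraFilter U}.
Context (U_free : forall n : nat, U [set k | (n <= k)%N]).

#[local] Instance los_proper : ProperFilter U := ultra_proper.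

Let N := ultrapower M U_free.

Definition uenv (G : seq (lsort L))
    (e : env (fun s => nat -> carrier M s) G) : tuples N G := @env_cls _ _ _ U _ _ e.

Lemma lookup_env_map (S : Type) (X Y : S -> Type) (j : forall s, X s -> Y s)
    (G : seq S) (s : S) (v : var G s) (e : env X G) :
  lookup v (env_map j e) = j s (lookup v e).
Proof. by elim: v e => //= {}G t u v IH [a e] /=. Qed.

(** For a list of terms, one tuple of sequences [e'] must serve both in the ultrapower and at every
    index; this is the input that function and predicate symbols expect. *)
Lemma los_term (G : seq (lsort L)) :
  (forall s (t : term G s) e,
    teval t (uenv e) = @ucls _ _ _ U _ s (fun k => teval t (env_at k e))) /\
  (forall H (ts : terms G H) e, exists e' : env (fun s => nat -> carrier M s) H,
    tseval ts (uenv e) = uenv e' /\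
    forall k, tseval ts (env_at k e) = env_at k e').
Proof.
apply: term_terms_ind.
- move=> s v e /=; rewrite /uenv /env_cls lookup_env_map; congr ucls.
  by apply/funext => k; rewrite /env_at lookup_env_map.
- move=> f ts IH e /=; have [e' [-> e'E]] := IH e.
  rewrite [LHS]ufinterp_cls; congr ucls.
  by apply/funext => k; rewrite e'E.
- by move=> e; exists tt.
- move=> s H t IHt ts IHts e; have [e' [tsE tskE]] := IHts e.
  exists ((fun k => teval t (env_at k e)), e'); split=> /=.
    by rewrite IHt tsE.
  by move=> k; rewrite tskE.
Qed.

Lemma range_ucarrier s (F : @ucarrier _ _ M U _ s -> R) :
  range F = range (fun f : nat -> carrier M s => F (ucls f)).
Proof.
apply/seteqP; split=> _ [z _ <-]; last by exists (ucls z).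
by exists (urepr z) => //; rewrite ureprK.
Qed.

(** Atomic formulas follow from the construction of the ultrapower, connectives from continuity, and
    quantifiers from the exchange of [sup] and [inf] with ultralimits, once ranges over classes are
    rewritten as ranges over sequences. *)
Theorem los (G : seq (lsort L)) (theta : formula G)
    (e : env (fun s => nat -> carrier M s) G) :
  (fun k => feval theta (env_at k e)) @ U --> feval theta (uenv e).
Proof.
elim: theta e => {G} [G s t1 t2|G P ts|G n u uc args IH|G s psi IH|G s psi IH] e /=.
- rewrite !(los_term G).1.
  by rewrite [X in _ --> X]mdist_ucls; exact: cvg_udist.
- have [e' [-> e'E]] := (los_term G).2 _ ts e.
  rewrite (_ : (fun k => _) = (fun k => pinterp (env_at k e'))).
    exact: cvg_pinterp.
  by apply/funext => k; rewrite e'E.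
- suff c : (fun k => \row_i feval (args i) (env_at k e)) @ U -->
      (\row_i feval (args i) (uenv e) : 'rV[R]_n) by exact: cvg_comp c (uc _).
  apply/cvg_ballP => eps eps0.
  have : \forall k \near U, forall j, ball (feval (args j) (uenv e)) eps
      (feval (args j) (env_at k e)).
    by apply: filter_forall => j; have /cvg_ballP/(_ _ eps0) := IH j e.
  by apply: filterS => k kj; split=> // i j; rewrite !mxE; exact: kj.
- have [B HB] := feval_bounded M psi.
  rewrite range_ucarrier.
  apply: (@ultra_cvg_sup _ _ _ _ _ (fun k a => feval psi (a, env_at k e)) B
    (fun f => feval psi (uenv ((f, e) : env _ (s :: G))))) => [|k a|a].
  + exact: carrier_nonempty.
  + exact: HB.
  + exact: (IH (a, e)).
- have [B HB] := feval_bounded M psi.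
  rewrite range_ucarrier.
  apply: (@ultra_cvg_inf _ _ _ _ _ (fun k a => feval psi (a, env_at k e)) B
    (fun f => feval psi (uenv ((f, e) : env _ (s :: G))))) => [|k a|a].
  + exact: carrier_nonempty.
  + exact: HB.
  + exact: (IH (a, e)).
Qed.

End Los.

Lemma env_map_cat (S : Type) (X Y : S -> Type) (j : forall s, X s -> Y s)
    (G H : seq S) (a : env X G) (b : env X H) :
  env_map j (env_cat a b) = env_cat (env_map j a) (env_map j b).
Proof. by elim: G a => [|s G IH] //= [u a] /=; rewrite IH. Qed.

Lemma env_seqP (S I : Type) (X : S -> Type) (G : seq S) (a : I -> env X G) :
  exists f : env (fun s => I -> X s) G,
    forall k, env_map (fun s (g : I -> X s) => g k) f = a k.
Proof.
elim: G a => [|s G IH] a; first by exists tt => k; case: (a k).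
have [f fE] := IH (fun k => (a k).2).
by exists ((fun k => (a k).1), f) => k /=; rewrite fE; case: (a k).
Qed.

(* The exact bound [delta] is recovered in an ultrapower of [M] from sequences
   in [M] whose bounds tend to [delta]; [M] itself need not be saturated. *)
Lemma stable_gap (R : realType) (L : language R) (T : theory L)
    (x y : seq (lsort L)) (phi : formula (x ++ y)) (delta : R)
    (M : structure L) : stable T phi delta -> models M T ->
  exists2 delta', delta' < delta &
    ~ exists (a : nat -> tuples M x) (b : nat -> tuples M y),
      forall i j : nat, (i < j)%N ->
        delta' <= `|feval2 phi (a i) (b j) - feval2 phi (a j) (b i)|.
Proof.
move=> st MT; apply: contrapT => nogap.
(* Without a gap, each bound [delta - 1/(k+1)] is reached in [M] by its own pair of sequences. *)
have /choice[ab abP] k : exists ab : (nat -> tuples M x) * (nat -> tuples M y),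
    forall i j : nat, (i < j)%N -> delta - k.+1%:R^-1 <=
      `|feval2 phi (ab.1 i) (ab.2 j) - feval2 phi (ab.1 j) (ab.2 i)|.
  apply: contrapT => nab; apply: nogap; exists (delta - k.+1%:R^-1).
    by rewrite ltrBlDr ltrDl invr_gt0.
  by move=> [a [b H]]; apply: nab; exists (a, b).
have [U [UU oo_U]] := @ultraFilterLemma nat \oo _.
have U_free n : U [set k | (n <= k)%N] by apply: oo_U; exists n.
have UF : ProperFilter U by exact: ultra_proper.
pose N := @ultrapower _ _ M U UU U_free.
(* The precision [k] becomes the index of the ultrapower, while [i] remains the index of the
   unstable sequence. *)
have /choice[A AP] i := env_seqP (fun k => (ab k).1 i).
have /choice[B BP] i := env_seqP (fun k => (ab k).2 i).
have lim i j : (fun k => feval2 phi ((ab k).1 i) ((ab k).2 j)) @ U -->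
    feval2 (M := N) phi (uenv U_free (A i)) (uenv U_free (B j)).
  rewrite /feval2 /uenv /env_cls -env_map_cat.
  rewrite (_ : (fun k => _) = fun k => feval phi (env_at k (env_cat (A i) (B j)))).
    exact: los.
  by apply/funext => k; rewrite /env_at env_map_cat AP BP.
apply: (st N).
  (* The ultrapower is a model of [T]: the value of an axiom is the ultralimit of the constant 0. *)
  move=> sigma /MT s0.
  refine (ultra_cvg_unique (@los _ _ M U UU U_free [::] sigma tt) _).
  rewrite (_ : (fun k => _) = fun=> 0); first exact: cvg_cst.
  exact/funext.
exists (fun i => uenv U_free (A i)), (fun i => uenv U_free (B i)) => i j ij.
(* For almost every [k] the loss [1/(k+1)] is below [e], so the full bound [delta] holds in the
   limit. *)
apply/ler_addgt0Pr => e e0; rewrite -lerBlDr.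
apply: (cvgr_to_ge (cvg_norm (cvgB (lim i j) (lim j i)))).
have [n _ nP] := near_infty_natSinv_lt (PosNum e0).
apply: filterS (U_free n) => k /nP /= kP.
by apply: le_trans (abP k i j ij); rewrite lerB// ltW.
Qed.

(** * Types are finitely satisfiable *)

Section Renaming.
Context (S : Type).
Implicit Types (G H K : seq S).

Definition renaming G H := forall s, var G s -> var H s.

(** The conditional return type ties [r] to the tail of the matched context, so that [r] applies to
    the variable under [VThere]. *)
Definition rename_lift t G H (r : renaming G H) : renaming (t :: G) (t :: H) :=
  fun s v =>
  match v in var G' s' return
    (if G' is t' :: G0 then renaming G0 H -> var (t' :: H) s' else unit)
  with
  | VHere _ _ => fun _ => VHere _ _
  | VThere _ _ _ v' => fun r => VThere _ (r _ v')
  end r.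

Definition var_nil (A : Type) (s : S) (v : var [::] s) : A :=
  match v in var G s return (if G is [::] then A else unit) with
  | VHere _ _ => tt
  | VThere _ _ _ _ => tt
  end.

Definition pulls (X : S -> Type) G H (r : renaming G H)
    (e : env X H) (e' : env X G) : Prop :=
  forall s (v : var G s), lookup (r s v) e = lookup v e'.

Lemma var_consP t G (P : forall s, var (t :: G) s -> Prop) :
  P t (VHere G t) -> (forall s v, P s (VThere t v)) -> forall s v, P s v.
Proof.
move=> P0 PS s v.
refine (match v as v0 in var G' s' return
  (if G' is t' :: G0 return var G' s' -> Prop then fun v0 =>
     forall P : forall s, var (t' :: G0) s -> Prop,
     P t' (VHere G0 t') -> (forall s v, P s (VThere t' v)) -> P s' v0
   else fun=> True) v0 with
  | VHere _ _ => fun _ P0 _ => P0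
  | VThere _ _ _ v' => fun _ _ PS => PS _ v'
  end P P0 PS).
Qed.

Lemma pulls_lift (X : S -> Type) t G H (r : renaming G H)
    (e : env X H) (e' : env X G) (u : X t) :
  pulls r e e' ->
  pulls (rename_lift r) ((u, e) : env X (t :: H)) ((u, e') : env X (t :: G)).
Proof. by move=> ree'; apply: var_consP. Qed.

Lemma rename_catl G H : exists r : renaming G (G ++ H),
  forall (X : S -> Type) (a : env X G) (b : env X H), pulls r (env_cat a b) a.
Proof.
elim: G => [|t G [r rP]]; last first.
  by exists (rename_lift r) => X [u a] b; exact: pulls_lift.
by exists (fun s => @var_nil _ s) => X a b s v; exact: var_nil v.
Qed.

Lemma rename_catr G H : exists r : renaming H (G ++ H),
  forall (X : S -> Type) (a : env X G) (b : env X H), pulls r (env_cat a b) b.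
Proof.
elim: G => [|t G [r rP]]; first by exists (fun s v => v) => X a b s v.
by exists (fun s v => VThere t (r s v)) => X [u a] b s v; exact: rP.
Qed.

(** Parameters are renamed under a fixed block [K]; this lets formulas with different parameter
    contexts be joined over the same type variables. *)
Lemma rename_cat_lift K G H (r : renaming G H) :
  exists r' : renaming (K ++ G) (K ++ H),
    forall (X : S -> Type) (a : env X K) (e : env X H) (e' : env X G),
      pulls r e e' -> pulls r' (env_cat a e) (env_cat a e').
Proof.
elim: K => [|t K [r' rP]]; first by exists r.
exists (rename_lift r') => X [u a] e e' ee'; apply: pulls_lift; exact: rP.
Qed.

End Renaming.

Section RenameFormula.
Context (R : realType) (L : language R).

Lemma rename_term (G H : seq (lsort L)) (r : renaming G H) :
  (forall s (t : term G s), exists t' : term H s,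
    forall (M : structure L) (e : tuples M H) (e' : tuples M G),
      pulls r e e' -> teval t' e = teval t e') /\
  (forall K (ts : terms G K), exists ts' : terms H K,
    forall (M : structure L) (e : tuples M H) (e' : tuples M G),
      pulls r e e' -> tseval ts' e = tseval ts e').
Proof.
apply: term_terms_ind.
- by move=> s v; exists (TVar (r s v)) => M e e' /= ->.
- move=> f ts [ts' tsP]; exists (TApp ts') => M e e' /= ee'.
  by rewrite (tsP _ _ _ ee').
- by exists (TNil _).
- move=> s K t [t' tP] ts [ts' tsP]; exists (TCons t' ts') => M e e' /= ee'.
  by rewrite (tP _ _ _ ee') (tsP _ _ _ ee').
Qed.

Lemma rename_formula (G H : seq (lsort L)) (r : renaming G H) (theta : formula G) :
  exists theta' : formula H,
    forall (M : structure L) (e : tuples M H) (e' : tuples M G),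
      pulls r e e' -> feval theta' e = feval theta e'.
Proof.
elim: theta H r => {G} [G s t1 t2|G P ts|G n u uc args IH|G s psi IH|G s psi IH] H r.
- have [t1' t1P] := (rename_term r).1 s t1; have [t2' t2P] := (rename_term r).1 s t2.
  exists (FDist t1' t2') => M e e' ee' /=.
  by rewrite (t1P _ _ _ ee') (t2P _ _ _ ee').
- have [ts' tsP] := (rename_term r).2 _ ts; exists (FPred ts') => M e e' ee' /=.
  by rewrite (tsP _ _ _ ee').
- have /choice[args' argsP] i := IH i H r.
  exists (FConn uc args') => M e e' ee' /=; congr u.
  by apply/matrixP => i j; rewrite !mxE; exact: argsP.
- have [psi' psiP] := IH _ (rename_lift r); exists (FSup psi') => M e e' ee' /=.
  congr sup; apply: eq_imagel => a _; apply: psiP; exact: pulls_lift.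
- have [psi' psiP] := IH _ (rename_lift r); exists (FInf psi') => M e e' ee' /=.
  congr inf; apply: eq_imagel => a _; apply: psiP; exact: pulls_lift.
Qed.

(** One [FInf] per variable of [x]; near-minimizers are found coordinate by coordinate, spending
    half of the error at each. *)
Lemma finf_tuple (x G : seq (lsort L)) (theta : formula (x ++ G)) :
  exists theta' : formula G, forall (M : structure L) (m : tuples M G),
    (forall a : tuples M x, feval theta' m <= feval theta (env_cat a m)) /\
    (forall eps, 0 < eps -> exists a : tuples M x,
      feval theta (env_cat a m) < feval theta' m + eps).
Proof.
elim: x theta => [|s x IH] theta.
  exists theta => M m; split=> // eps eps0; exists tt => /=.
  by rewrite ltrDl.
have [theta' thetaP] := IH (FInf theta); exists theta' => M m.
have [le_inf lt_inf] := thetaP M m.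
have [B HB] := feval_bounded M theta.
pose g a (u : carrier M s) := feval theta ((u, env_cat a m) : tuples M (s :: x ++ G)).
have lbg a : has_lbound (range (g a)).
  exists (- B) => _ [v _ <-].
  by have := HB ((v, env_cat a m) : tuples M (s :: x ++ G)); rewrite ler_norml => /andP[].
split=> [[u a]|eps eps0].
  by apply: le_trans (le_inf a) _ => /=; apply: ge_inf; [exact: lbg|exists u].
have [a aP] := lt_inf _ (divr_gt0 eps0 (ltr0n R 2)).
have [|_ [u _ <-] uP] := @inf_adherent _ (range (g a)) _ (divr_gt0 eps0 (ltr0n R 2)).
  by split; [have [u] := carrier_nonempty M s; exists (g a u), u|exact: lbg].
exists (u, a); apply: lt_trans uP _.
by rewrite [eps in _ < _ + eps](splitr eps) addrA ltrD2r.
Qed.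

End RenameFormula.

(** * Approximate realization of types inside the model *)

Section FiniteSatisfiability.
Context (R : realType) (L : language R) (M : structure L).
Context (x y : seq (lsort L)) (phi : formula (x ++ y)).

(** The real targets [c b] are absorbed into the connectives, as every continuous function is one,
    and the parameter tuples are concatenated. A formula common to all [N] allows elementarity to
    compare [M] with an extension. *)
Lemma max_dist_formula (c : tuples M y -> R) (bs : seq (tuples M y)) :
  exists (G : seq (lsort L)) (theta : formula (x ++ G)) (m : tuples M G),
  forall (N : structure L) (j : forall s, carrier M s -> carrier N s)
      (a : tuples N x),
    feval2 theta a (env_map j m : tuples N G) =
    foldr (fun b r => Num.max `|feval2 phi a (env_map j b : tuples N y) - c b| r)
      0 bs.
Proof.
elim: bs => [|b bs [G [theta [m thetaP]]]].
  pose u0 (v : 'rV[R]_0) : R := 0.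
  have u0c : continuous u0 by exact: cst_continuous.
  exists [::], (@FConn _ _ _ 0 u0 u0c
    (fun i => match notF (ltn_ord i) with end)), tt.
  by [].
have [rl rlP] := rename_catl y G; have [rr rrP] := rename_catr y G.
have [rl' rlP'] := rename_cat_lift x rl; have [rr' rrP'] := rename_cat_lift x rr.
have [phi' phiP] := rename_formula rl' phi.
have [theta' thetaP'] := rename_formula rr' theta.
pose u (v : 'rV[R]_2) : R := Num.max `|v 0 0 - c b| (v 0 1).
have uc : continuous u.
  move=> v.
  have v0 : (fun w : 'rV[R]_2 => w 0 0 - c b) @ v --> v 0 0 - c b.
    have v0 : (fun w : 'rV[R]_2 => w 0 0) @ v --> v 0 0.
      exact: (@coord_continuous R 1 2 0 0 v).
    exact: cvgB v0 (cvg_cst _).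
  apply: (@continuous_max R _ (fun w : 'rV[R]_2 => `|w 0 0 - c b|)
    (fun w : 'rV[R]_2 => w 0 1)); first exact: cvg_norm v0.
  exact: (@coord_continuous R 1 2 0 1 v).
exists (y ++ G), (FConn uc (fun i => if i == 0 then phi' else theta')),
  (env_cat b m).
move=> N j a; rewrite /feval2 /= /u !mxE /= env_map_cat -thetaP.
rewrite (phiP _ _ (env_cat a (env_map j b))); last exact: rlP'.
by rewrite (thetaP' _ _ (env_cat a (env_map j m)))//; exact: rrP'.
Qed.

(** In the extension the realization [a0] brings the maximal error on [bs] down to 0, so its infimum
    over [x] is at most 0. This infimum is a formula over [M], so by elementarity it is at most 0 in
    [M] too, where some tuple comes within [eps] of it. *)
Lemma type_finitely_satisfiable (p : type_space M x) (bs : seq (tuples M y))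
    (eps : R) : 0 < eps ->
  exists a : tuples M x, forall b, List.In b bs ->
    `|feval2 phi a b - phi_val phi p b| < eps.
Proof.
move=> eps0; case: p => p [N [j [a0 [el pE]]]].
rewrite /phi_val /type_val /=.
pose c b := p (PFormula phi b).
have [G [theta [m thetaP]]] := max_dist_formula c bs.
have [theta' theta'P] := finf_tuple theta.
have [a aP] := (theta'P M m).2 _ eps0.
have inf0 : feval theta' m <= 0.
  rewrite -el; apply: le_trans ((theta'P N _).1 a0) _.
  have := thetaP N j a0; rewrite /feval2 => ->.
  elim: bs {thetaP} => //= b bs IH; rewrite ge_max IH andbT.
  by rewrite /c pE /feval2 subrr normr0.
exists a => b bbs.
have := thetaP M (fun _ u => u) a; rewrite env_map_id /feval2 => thetaE.
have : feval theta (env_cat a m) < eps.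
  by apply: lt_le_trans aP _; rewrite -{2}[eps]add0r lerD2r.
rewrite thetaE {thetaP thetaE}.
elim: bs bbs => //= b' bs IH bbs; rewrite gt_max => /andP[].
by case: bbs => [->|/IH {}IH]; rewrite env_map_id.
Qed.

End FiniteSatisfiability.

(** * Small relatively open pieces *)

(** Dependent choice on finite histories, newest entry first, for constructions whose next term must
    suit all earlier ones at once. *)
Lemma history_seq (T : Type) (inv : seq T -> Prop) (r : T -> T -> Prop) :
  inv [::] ->
  (forall s, inv s -> exists t, inv (t :: s) /\ forall u, List.In u s -> r u t) ->
  exists h : nat -> T, forall i j, (i < j)%N -> r (h i) (h j).
Proof.
move=> inv0 step.
have [t0 _] := step _ inv0.
have /choice[f fP] s : exists t, inv s ->
    inv (t :: s) /\ forall u, List.In u s -> r u t.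
  have [/step[t tP]|ns] := pselect (inv s); first by exists t.
  by exists t0.
pose hist := fix hist n := if n is n'.+1 then f (hist n') :: hist n' else [::].
have inv_hist n : inv (hist n) by elim: n => //= n /fP[].
exists (fun n => f (hist n)) => i j ij; apply: (fP _ (inv_hist j)).2.
elim: j ij => // j IH; rewrite ltnS leq_eqVlt => /predU1P[->|/IH ?]; first by left.
by right.
Qed.

(** A free ultrafilter decides, for each [i], whether [P i j] holds for most [j], and then which
    answer is given by most [i]. Terms with that answer are chosen greedily from sets of [U]. *)
Lemma ramsey_pairs (P : nat -> nat -> Prop) : exists h : nat -> nat,
  (forall i j, (i < j)%N -> (h i < h j)%N) /\
  ((forall i j, (i < j)%N -> P (h i) (h j)) \/
   (forall i j, (i < j)%N -> ~ P (h i) (h j))).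
Proof.
have [U [UU oo_U]] := @ultraFilterLemma nat \oo _.
have UF : ProperFilter U by exact: ultra_proper.
have homogeneous (Q : nat -> nat -> Prop) : U [set i | U [set j | Q i j]] ->
    exists h : nat -> nat,
      forall i j, (i < j)%N -> (h i < h j)%N /\ Q (h i) (h j).
  move=> UQ; pose r i j := (i < j)%N /\ Q i j.
  apply: (@history_seq nat
    (fun s => forall i, List.In i s -> U [set j | Q i j]) r) => //.
  move=> s sP.
  have Us : U [set j | forall i, List.In i s -> r i j].
    elim: s sP => [_|i s IH sP]; first by apply: filterS filterT.
    have {}IH : U [set j | forall i, List.In i s -> r i j].
      by apply: IH => k ks; apply: sP; right.
    have Ui : U [set j | (i < j)%N] by apply: oo_U; exists i.+1.
    have UQi : U [set j | Q i j] by apply: sP; left.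
    apply: filterS (filterI (filterI Ui UQi) IH) => j [[ij Qij] sj] k [<-|] //.
    exact: sj.
  have [t [tQ ts]] := filter_ex (filterI UQ Us).
  by exists t; split=> // i [<-|/sP].
have [UP|UnP] := in_ultra_setVsetC [set i | U [set j | P i j]] UU.
  have [h hP] := homogeneous _ UP.
  by exists h; split=> [i j /hP[]|]//; left=> i j /hP[].
have [|h hP] := homogeneous (fun i j => ~ P i j).
  by apply: filterS UnP => i nUP; case: (in_ultra_setVsetC [set j | P i j] UU).
by exists h; split=> [i j /hP[]|]//; right=> i j /hP[].
Qed.

(** * Fragmentation, with [X] for types, [A] for tuples realizing them approximately and [B] for
    parameters *)

Section Fragmentation.
Context (R : realType) (X : topologicalType) (A B : Type).
Context (f : X -> B -> R) (F : A -> B -> R).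
Hypothesis f_cont : forall b, continuous (f^~ b).
Hypothesis f_unit : forall p b, 0 <= f p b <= 1.
Hypothesis F_unit : forall a b, 0 <= F a b <= 1.
Hypothesis f_approx : forall p (bs : seq B) e, 0 < e ->
  exists a, forall b, List.In b bs -> `|F a b - f p b| < e.

(** For each [a] the unit interval is cut into buckets of width [e]; a colour records the bucket of
    [F a b] for every [a] in [s]. *)
Lemma finite_coloring (s : seq A) (e : R) : 0 < e ->
  exists (C : finType) (col : B -> C), forall b b', col b = col b' ->
    forall a, List.In a s -> `|F a b - F a b'| <= e.
Proof.
move=> e0; elim: s => [|a s [C [col colP]]].
  by exists unit, (fun=> tt).
pose n := Num.truncn e^-1.
exists (C * 'I_n.+1)%type, (fun b => (col b, inord (Num.truncn (F a b / e)))).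
move=> b b' [/colP cs ab] a' [<-|/cs//].
have Fe c : 0 <= F a c / e.
  by rewrite divr_ge0 ?(ltW e0)//; case/andP: (F_unit a c).
have small c : (Num.truncn (F a c / e) < n.+1)%N.
  rewrite ltnS le_truncn// ler_piMl ?invr_ge0 ?(ltW e0)//.
  by case/andP: (F_unit a c).
have {}ab : Num.truncn (F a b / e) = Num.truncn (F a b' / e).
  by rewrite -(inordK (small b)) ab inordK.
have /andP[l1 u1] := truncn_itv (Fe b); have /andP[l2 u2] := truncn_itv (Fe b').
(* After division by [e] the two values have the same integer part, so they differ by at most 1. *)
rewrite -(ler_pM2r (x := e^-1)) ?invr_gt0// divff ?gt_eqF//.
rewrite -[X in _ * X]gtr0_norm ?invr_gt0// -normrM mulrBl ler_norml.
move: u1 u2 l1 l2; rewrite -ab -natr1; lra.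
Qed.

Lemma approx_gaps p (c : R) (l : seq (B * B)) :
  (forall u, List.In u l -> c < f p u.1 - f p u.2) ->
  exists a, forall u, List.In u l -> c < F a u.1 - F a u.2.
Proof.
move=> lP.
have [r r0 rP] : exists2 r, 0 < r &
    forall u, List.In u l -> c + r + r < f p u.1 - f p u.2.
  elim: l lP => [|u l IH] lP; first by exists 1.
  have [r r0 rP] : exists2 r, 0 < r &
      forall u, List.In u l -> c + r + r < f p u.1 - f p u.2.
    by apply: IH => v vl; apply: lP; right.
  have : c < f p u.1 - f p u.2 by apply: lP; left.
  set d := f p u.1 - f p u.2 => cd.
  (* The quarter keeps [c + 2 * r < d] strict; the slack [2 * r] absorbs an error [r] at each entry
     of a pair. *)
  exists (Num.min r ((d - c) / 4)); first by rewrite lt_min r0 divr_gt0// subr_gt0.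
  move=> v [<-|/rP vP]; rewrite -/d.
    have : Num.min r ((d - c) / 4) <= (d - c) / 4 by rewrite ge_min lexx orbT.
    by move: cd; lra.
  have : Num.min r ((d - c) / 4) <= r by rewrite ge_min lexx.
  by move: vP; lra.
have [a aP] := f_approx p ([seq u.1 | u <- l] ++ [seq u.2 | u <- l]) r0.
exists a => u ul; have := rP u ul.
have := aP u.1 (List.in_or_app _ _ _ (or_introl (List.in_map _ _ _ ul))).
have := aP u.2 (List.in_or_app _ _ _ (or_intror (List.in_map _ _ _ ul))).
by rewrite !ltr_norml; lra.
Qed.

Context (gamma delta : R) (K : set X).
Hypothesis gamma_delta : gamma < delta.
Hypothesis no_gap : ~ exists (a : nat -> A) (b : nat -> B),
  forall i j : nat, (i < j)%N -> gamma <= `|F (a i) (b j) - F (a j) (b i)|.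

(** This value gives both [gamma + delta + e = 2 * delta] and [2 * gamma + e = gamma + delta], used
    respectively for shrinking and for the contradiction. *)
Let e := delta - gamma.
Let e_gt0 : 0 < e. Proof. by rewrite subr_gt0. Qed.

Lemma shrink_colors (C : finType) (col : B -> C) (V : set X) :
  open V -> V `&` K !=set0 ->
  (forall p b b', (V `&` K) p -> col b = col b' ->
    f p b - f p b' <= gamma + delta) ->
  forall cs : seq C, exists W : set X,
    [/\ open W, W `<=` V, W `&` K !=set0 &
      forall p q b, (W `&` K) p -> (W `&` K) q -> col b \in cs ->
        f p b - f q b <= 2 * delta].
Proof.
move=> oV VK colP; elim=> [|c cs [W [oW WV WK WP]]].
  by exists V; split.
pose S := [set r | exists p b, [/\ (W `&` K) p, col b = c & r = f p b]].
have [S0|S0] := pselect (S !=set0); last first.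
  (* No parameter has colour [c], so [W] already works. *)
  exists W; split=> // p q b Wp Wq; rewrite inE => /predU1P[bc|]; last exact: WP.
  by exfalso; apply: S0; exists (f p b), p, b.
have supS : has_sup S.
  by split=> //; exists 1 => _ [p [b [_ _ ->]]]; case/andP: (f_unit p b).
have [_ [p0 [b0 [[Wp0 Kp0] b0c ->]]] p0S] := sup_adherent e_gt0 supS.
exists (W `&` (f^~ b0) @^-1` [set r | sup S - e < r]); split.
- apply: openI => //; apply: open_comp => [? _|]; first exact: f_cont.
  exact: open_gt.
- by move=> q [/WV].
- by exists p0.
(* The chain is [f p b <= sup S < f q b0 + e <= f q b + gamma + delta + e]. *)
- move=> p q b [[Wp pS] Kp] [[Wq qS] Kq]; rewrite inE => /predU1P[bc|]; last first.
    by apply: WP.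
  have pb : f p b <= sup S.
    by apply: ub_le_sup; [case: supS|exists p, b].
  have qb : f q b0 - f q b <= gamma + delta.
    by apply: colP; [split=> //; exact: WV|rewrite b0c bc].
  move: pb qb qS; rewrite /= /e; lra.
Qed.

(** Here [u] is the earlier entry: its [a] hardly separates the later pair of parameters, whereas
    the later [a] separates the earlier pair widely. *)
Let gap2 (u v : A * (B * B)) := `|F u.1 v.2.1 - F u.1 v.2.2| <= e /\
  gamma + delta < F v.1 u.2.1 - F v.1 u.2.2.

(** If both the first and the second parameters stayed below [gamma] at a pair of indices, the wide
    gap would be less than [2 * gamma + e = gamma + delta]. So one of them violates
    [gamma]-stability at each pair, and Ramsey makes it the same one along a subsequence. *)
Lemma no_gap2_seq : ~ exists h : nat -> A * (B * B),
  forall i j, (i < j)%N -> gap2 (h i) (h j).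
Proof.
move=> [h hP]; apply: no_gap.
pose P i j := gamma <= `|F (h i).1 (h j).2.1 - F (h j).1 (h i).2.1|.
have [g [g_lt [gP|gP]]] := ramsey_pairs P.
  by exists (fun i => (h (g i)).1), (fun i => (h (g i)).2.1).
exists (fun i => (h (g i)).1), (fun i => (h (g i)).2.2) => i j ij.
have [+ +] := hP _ _ (g_lt _ _ ij); have /negP := gP _ _ ij.
rewrite -ltNge ltr_norml ler_norml lter_normr /e; lra.
Qed.

Lemma small_open_piece : K !=set0 -> exists V : set X,
  [/\ open V, V `&` K !=set0 &
    forall p q, (V `&` K) p -> (V `&` K) q ->
      forall b, `|f p b - f q b| <= 2 * delta].
Proof.
move=> K0; apply: contrapT => noV; apply: no_gap2_seq.
(* The invariant keeps an open piece of [K] on which all parameter pairs chosen so far remain widely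
   separated. *)
pose inv (s : seq (A * (B * B))) := exists V : set X,
  [/\ open V, V `&` K !=set0 &
    forall q, (V `&` K) q -> forall u, List.In u s ->
      gamma + delta < f q u.2.1 - f q u.2.2].
apply: (@history_seq _ inv gap2).
  by exists setT; split; [exact: openT|rewrite setTI|].
move=> s [V [oV VK Vs]].
have [C [col colP]] := finite_coloring [seq u.1 | u <- s] e_gt0.
(* Otherwise shrinking through all colours would produce a small piece, against [noV]. *)
have [p [b [b' [[Vp Kp] bb' pbb']]]] : exists p b b',
    [/\ (V `&` K) p, col b = col b' & gamma + delta < f p b - f p b'].
  apply: contrapT => nbb'; apply: noV.
  have [|W [oW _ WK WP]] := @shrink_colors C col V oV VK _ (enum C).
    move=> p b b' pVK bb'; rewrite leNgt; apply/negP => lt_pb.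
    by apply: nbb'; exists p, b, b'.
  exists W; split=> // p q pW qW b; rewrite ler_norml lerNl opprB.
  by rewrite !WP// mem_enum.
pose W := V `&` ((fun q => f q b - f q b') @^-1` [set r | gamma + delta < r]).
have oW : open W.
  apply: openI => //; apply: open_comp => [q _|]; last exact: open_gt.
  by apply: cvgB; exact: f_cont.
have WP q : (W `&` K) q -> forall u, List.In u ((b, b') :: [seq v.2 | v <- s]) ->
    gamma + delta < f q u.1 - f q u.2.
  move=> [[Vq qb] Kq] u [<-//|/List.in_map_iff[v [<- vs]]].
  exact: Vs (conj Vq Kq) _ vs.
have Wp : (W `&` K) p by [].
(* The new [a] imitates [p] on the old pairs and on the new one, so it separates them all. *)
have [a aP] := approx_gaps (WP p Wp).
exists (a, (b, b')); split.
  exists W; split=> //; first by exists p.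
  move=> q qW u [<-|us]; first by apply: (WP q qW (b, b')); left.
  by apply: (WP q qW u.2); right; exact: List.in_map.
move=> u us; split=> /=; last by apply: (aP u.2); right; exact: List.in_map.
by apply: colP => //; exact: List.in_map.
Qed.

End Fragmentation.

(** * Exhausting a regular measure *)

Section RegularDecomposition.
Context (R : realType) (X : ptopologicalType) (mu : probability (borel X) R).
Context (small : set X -> Prop).
Hypothesis X_hausdorff : hausdorff_space X.
Hypothesis mu_regular : regular_measure mu.
Hypothesis small_sub : forall A B : set X, A `<=` B -> small B -> small A.
Hypothesis fragment : forall K : set X, K !=set0 ->
  exists V : set X, [/\ open V, V `&` K !=set0 & small (V `&` K)].

Let mset : set (set X) := @measurable _ (borel X).

Lemma open_borel (V : set X) : open V -> mset V.
Proof. exact: sub_sigma_algebra. Qed.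

Lemma closed_borel (C : set X) : closed C -> mset C.
Proof.
move=> cC; rewrite -[C]setCK; apply: measurableC.
by apply: open_borel; exact: closed_openC.
Qed.

Lemma inner_compact (B : set X) : mset B -> (0 < mu B)%E ->
  exists K : set X, [/\ compact K, closed K, K `<=` B & (0 < mu K)%E].
Proof.
move=> mB; have [_ ->] := mu_regular mB.
move=> /ereal_sup_gt[_ [K [cK KB] <-] K0].
by exists K; split=> //; exact: compact_closed.
Qed.

Lemma null_fset_cover (I : choiceType) (V : I -> set X) (s : seq I) (K : set X) :
  mset K -> (forall i, i \in s -> open (V i) /\ mu (V i `&` K) = 0%E) ->
  K `<=` \big[setU/set0]_(i <- s) V i -> mu K = 0%E.
Proof.
move=> mK Vs KV; apply/eqP; rewrite -measure_le0.
suff [mV V0] : mset (\big[setU/set0]_(i <- s) V i `&` K) /\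
    mu (\big[setU/set0]_(i <- s) V i `&` K) = 0%E.
  rewrite -V0; apply: le_measure; rewrite ?inE// => x Kx; split=> //; exact: KV.
elim: s Vs {KV} => [|i s IH] Vs.
  by rewrite big_nil set0I; split; [exact: measurable0|exact: measure0].
have [|mVs Vs0] := IH; first by move=> j js; apply: Vs; rewrite inE js orbT.
have [oVi Vi0] := Vs i (mem_head _ _).
have mVi : mset (V i `&` K) by apply: measurableI => //; exact: open_borel.
rewrite big_cons setIUl; split; first exact: measurableU.
apply/eqP; rewrite -measure_le0; apply: le_trans (measureU2 _ mVi mVs) _.
by rewrite [X in (X + _)%E]Vi0 [X in (_ + X)%E]Vs0 adde0.
Qed.

(** Every nonempty relatively open piece of the support has positive measure. Hence a small one
    exists with positive measure, and inner regularity gives a closed set inside it. *)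
Lemma small_closed_piece (B : set X) : mset B -> (0 < mu B)%E ->
  exists C : set X, [/\ closed C, C `<=` B, (0 < mu C)%E & small C].
Proof.
move=> mB /(inner_compact mB)[K [_ clK KB K0]].
pose null := [set V : set X | open V /\ mu (V `&` K) = 0%E].
pose W := \bigcup_(V in null) V.
have oW : open W by apply: bigcup_open => V [].
have mK := closed_borel clK; have mW := open_borel oW.
(* [K `\` W] is the support of the restriction of [mu] to [K]. *)
have W0 : mu (K `&` W) = 0%E.
  apply/eqP; rewrite -measure_le0 leNgt; apply/negP.
  move=> /inner_compact[|K' [cK' clK' K'W]].
    exact: measurableI.
  apply/negP; rewrite -leNgt measure_le0; apply/eqP.
  have mK' := closed_borel clK'.
  rewrite compact_cover in cK'.
  have [||D Dnull K'D] := cK' (set X) null id; first by move=> V [].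
    by move=> z /K'W[].
  apply: (@null_fset_cover (set X) id (finmap.enum_fset D)) => //.
    move=> V /Dnull; rewrite inE => -[oV V0]; split=> //.
    apply/eqP; rewrite -measure_le0 -V0; apply: le_measure; rewrite ?inE.
    + by apply: measurableI => //; exact: open_borel.
    + by apply: measurableI => //; exact: open_borel.
    + by move=> z [Vz /K'W[Kz _]].
  by rewrite -bigcup_fset.
pose S := K `\` W.
have mS : mset S by exact: measurableD.
have S0 : mu S = mu K.
  by rewrite [RHS](measureDI mu mK mW) [X in (_ + X)%E]W0 adde0.
have [V [oV [z [Vz Sz]] sV]] : exists V : set X,
    [/\ open V, V `&` S !=set0 & small (V `&` S)].
  apply: fragment; apply/set0P/eqP => S00.
  by move: K0; rewrite -S0 S00 measure0 ltxx.
have mV := open_borel oV.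
(* If this piece were null, [V] would be one of the open sets forming [W], contradicting that [z]
   lies outside [W]. *)
have VS0 : (0 < mu (V `&` S))%E.
  rewrite lt0e measure_ge0 andbT; apply/eqP => VS0.
  case: Sz => _; apply; exists V => //; split=> //.
  apply/eqP; rewrite -measure_le0.
  have mVS : mset (V `&` S) by exact: measurableI.
  have mKW : mset (K `&` W) by exact: measurableI.
  apply: (@le_trans _ _ (mu ((V `&` S) `|` (K `&` W)))).
    apply: le_measure; rewrite ?inE; [exact: measurableI|exact: measurableU|].
    move=> t [Vt Kt]; have [Wt|nWt] := pselect (W t); first by right.
    by left.
  apply: le_trans (measureU2 _ mVS mKW) _.
  by rewrite [X in (X + _)%E]VS0 [X in (_ + X)%E]W0 adde0.
have [C [_ clC CVS C0]] := inner_compact (measurableI _ _ mV mS) VS0.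
exists C; split=> //; last exact: small_sub sV.
by move=> t /CVS[_ [Kt _]]; exact: KB.
Qed.

(* [C = set0] when no small closed subset of [B] has positive measure. *)
Let pick_spec (B C : set X) := [/\ closed C, C `<=` B, C !=set0 -> small C &
  forall C', closed C' -> C' `<=` B -> small C' ->
    (fine (mu C') <= 2 * fine (mu C))%R].

Let fin C : mset C -> mu C \is a fin_num.
Proof. exact: fin_num_measure. Qed.

(** The supremum of the available measures may not be attained; a set above half of it suffices. *)
Let pick_ex (B : set X) : exists C, pick_spec B C.
Proof.
pose M := [set r | exists C, [/\ closed C, C `<=` B, small C & r = fine (mu C)]].
have [[C0 [clC0 C0B sC0 C0gt]]|none] := pselect (exists C,
    [/\ closed C, C `<=` B, small C & 0 < fine (mu C)]); last first.
  exists set0; split=> //; first exact: closed0.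
    by move=> [].
  move=> C' clC' C'B sC'; rewrite measure0/= mulr0 leNgt; apply/negP => C'0.
  by apply: none; exists C'.
have supM : has_sup M.
  split; first by exists (fine (mu C0)), C0.
  exists 1 => _ [C [clC _ _ ->]]; have mC := closed_borel clC.
  by rewrite -lee_fin fineK ?fin// probability_le1.
have s0 : 0 < sup M.
  by apply: lt_le_trans C0gt _; apply: ub_le_sup; [case: supM|exists C0].
have [_ [C [clC CB sC ->]] CM] := sup_adherent (divr_gt0 s0 (ltr0n R 2)) supM.
exists C; split=> // C' clC' C'B sC'.
have : fine (mu C') <= sup M by apply: ub_le_sup; [case: supM|exists C'].
by move: CM; lra.
Qed.

(** Greedy exhaustion: if the leftover [Z] had positive measure, a small closed [C'] inside it would
    be available at every stage. Each pick would then have at least half the measure of [C'], and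
    disjoint picks would exceed total mass 1. *)
Theorem regular_decomposition :
  exists (I : countType) (C : I -> set X),
    [/\ trivIset [set: I] C,
        forall i, closed (C i),
        forall i, small (C i) /\ (0 < mu (C i))%E
      & forall B : set (borel X), measurable B ->
          mu B = (\esum_(i in [set: I]) (mu (C i) * localization mu (C i) B))%E].
Proof.
have /choice[pick pickP] := pick_ex.
pose rest := fix rest n := if n is n'.+1 then rest n' `\` pick (rest n') else setT.
pose C n := pick (rest n).
have clC n : closed (C n) by case: (pickP (rest n)).
have mC n : mset (C n) by exact: closed_borel.
have mrest n : mset (rest n).
  by elim: n => [|n IH]; [exact: measurableT|exact: (measurableD IH (mC n))].
have rest_sub m n : (m <= n)%N -> rest n `<=` rest m.
  elim: n => [|n IH]; first by rewrite leqn0 => /eqP->.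
  rewrite leq_eqVlt => /predU1P[->//|]; rewrite ltnS => /IH mn z /= [/mn].
  by [].
have CR n : C n `<=` rest n by case: (pickP (rest n)).
have disj m n : (m < n)%N -> C m `&` C n = set0.
  move=> mn; apply/seteqP; split=> // z [Cm /CR /(rest_sub _ _ mn) /= [_]].
  exact.
have tC : trivIset setT C.
  apply/trivIsetP => m n _ _; rewrite neq_ltn => /orP[/disj//|/disj].
  by rewrite setIC.
have restE n : rest n = ~` \bigcup_(i < n) C i.
  elim: n => [|n IH]; first by rewrite bigcup_mkord big_ord0 setC0.
  by rewrite bigcup_mkord big_ord_recr /= setCU -bigcup_mkord -IH setDE.
pose Z := ~` \bigcup_i C i.
have mU : mset (\bigcup_i C i) by exact: bigcupT_measurable.
have mZ : mset Z by exact: measurableC.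
have Z_rest n : Z `<=` rest n.
  by rewrite restE; apply: subsetC => z [i _ Ciz]; exists i.
have Z0 : mu Z = 0%E.
  apply/eqP; rewrite -measure_le0 leNgt; apply/negP => /(small_closed_piece mZ).
  move=> [C' [clC' C'Z C'0 sC']].
  have mC' := closed_borel clC'.
  have c0 : 0 < fine (mu C') by rewrite -lte_fin fineK ?fin.
  have C_ge n : fine (mu C') <= 2 * fine (mu (C n)).
    by have [_ _ _] := pickP (rest n); apply=> // z /C'Z; exact: Z_rest.
  have rest_le n : fine (mu (rest n)) <= 1 - n%:R * (fine (mu C') / 2).
    elim: n => [|n IH]; first by rewrite mul0r subr0 /= probability_setT.
    have restD : fine (mu (rest n)) = fine (mu (rest n.+1)) + fine (mu (C n)).
      by rewrite -fineD ?fin// (measureDI mu (mrest n) (mC n)) (setIidr (@CR n)).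
    move: IH restD (C_ge n); rewrite -(natr1 n); lra.
  have [n nP] : exists n, 2 / fine (mu C') < n%:R.
    by exists (Num.truncn (2 / fine (mu C'))).+1; exact: truncnS_gt.
  have := rest_le n; rewrite leNgt => /negP; apply.
  apply: (@lt_le_trans _ _ 0); last by rewrite fine_ge0.
  move: nP; rewrite ltr_pdivrMr//; lra.
(* Null picks, in particular empty ones, are dropped, which makes every remaining piece both
   nonempty and small. *)
pose I : countType := {n : nat | `[< (0 < mu (C n))%E >]}.
exists I, (fun i => C (val i)); split.
- by move=> i j _ _ /(tC _ _ Logic.I Logic.I) ij; apply: val_inj.
- by move=> i; exact: clC.
- move=> [n /= /asboolP n0]; split=> //.
  have [_ _ + _] := pickP (rest n); apply.
  by apply/set0P/eqP => Cn0; move: n0; rewrite /C Cn0 measure0 ltxx.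
- move=> B mB.
  have mBC n : mset (B `&` C n) by exact: (measurableI _ _ mB (mC n)).
  have -> : (\esum_(i in [set: I]) (mu (C (val i)) * localization mu (C (val i)) B) =
      \esum_(i in [set: I]) (fun n => mu (B `&` C n)) (val i))%E.
    apply: eq_esum => -[n /= /asboolP n0] _; rewrite /localization.
    rewrite muleCA -{1}[mu (C n)]fineK ?fin// -EFinM divff ?mule1//.
    by rewrite gt_eqF// -lte_fin fineK ?fin.
  (* The sum passes to all natural numbers, since null picks contribute 0. Countable additivity then
     handles the part of [B] covered by the pieces; the rest lies in the null set [Z]. *)
  rewrite -(@reindex_esum _ _ _ _ [set n | (0 < mu (C n))%E] _
    (fun n => mu (B `&` C n))).
    rewrite esum_mkcond (eq_esum (b := fun n => mu (B `&` C n))); last first.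
      move=> n _; case: ifPn => // /negP; rewrite inE /= => n0.
      apply/esym/eqP; rewrite -measure_le0; apply: (@le_trans _ _ (mu (C n))).
        by apply: le_measure; rewrite ?inE; [exact: mBC|exact: mC|move=> z []].
      by rewrite leNgt; exact/negP.
    rewrite -nneseries_esumT// -measure_semi_bigcup//.
    + rewrite -setI_bigcupr (measureDI mu mB mU) -[RHS]add0e; congr (_ + _)%E.
      apply/eqP; rewrite -measure_le0 -Z0; apply: le_measure; rewrite ?inE.
      * exact: (measurableD mB mU).
      * exact: mZ.
      * by move=> z [].
    + exact: trivIset_setIl.
    + by apply: bigcupT_measurable.
  split.
  + by move=> [n /= /asboolP].
  + by move=> i j _ _; exact: val_inj.
  + by move=> n n0; exists (exist _ n (introT (asboolP _) n0)).
Qed.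

End RegularDecomposition.

(** * Local type spaces *)

Section LocalTypes.
Context (R : realType) (L : language R) (M : structure L).
Context (x y : seq (lsort L)) (phi : formula (x ++ y)).

Lemma phi_val_continuous (b : tuples M y) :
  continuous (fun p : type_space M x => phi_val phi p b).
Proof.
move=> p; have tv : continuous (@type_val R L M x) by exact: initial_continuous.
exact: cvg_comp (tv p) (@proj_continuous _ _ (PFormula phi b) (type_val p)).
Qed.

Lemma local_val_continuous (b : tuples M y) :
  continuous (fun p : local_type_space M phi => local_val p b).
Proof.
apply: (@repr_comp_continuous _ _ _ (fun p => phi_val phi p b)).
  exact: phi_val_continuous.
by move=> p q /eqP/eqmodP/asboolP pq; apply/eqP.
Qed.

Lemma local_val_inj (p q : local_type_space M phi) :
  (forall b, local_val p b = local_val q b) -> p = q.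
Proof.
move=> pq; rewrite -[p]reprK -[q]reprK; apply/eqmodP; exact/asboolP.
Qed.

(** The continuous real functions [local_val] separate the points of the quotient. *)
Lemma local_type_hausdorff : hausdorff_space (local_type_space M phi).
Proof.
move=> p q pq; apply: local_val_inj => b; apply: (@Rhausdorff R) => A B Ap Bq.
have [z [Az Bz]] := pq _ _ (local_val_continuous Ap) (local_val_continuous Bq).
by exists (local_val z b).
Qed.

(** A type takes its values in an elementary extension, which is again a model of [T]. *)
Lemma local_val_unit (T : theory L) (p : local_type_space M phi) b :
  unit_valued T phi -> models M T -> 0 <= local_val p b <= 1.
Proof.
move=> phi01 MT; rewrite /local_val /phi_val /type_val.
case: (repr p) => /= f [N [j [a [el ->]]]]; apply: phi01 => sigma /MT <-.
exact: (el [::] sigma tt).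
Qed.

Lemma local_diam_le (C : set (local_type_space M phi)) (r : R) :
  (forall p q, C p -> C q -> forall b, `|local_val p b - local_val q b| <= r) ->
  (local_diam C <= r%:E)%E.
Proof.
move=> Cr; apply: ge_ereal_sup => _ [[p q] [/= Cp Cq] <-].
by apply: ge_ereal_sup => _ [b _ <-]; rewrite lee_fin; exact: Cr.
Qed.

Lemma local_diam_sub (C D : set (local_type_space M phi)) :
  C `<=` D -> (local_diam C <= local_diam D)%E.
Proof.
move=> CD; apply: le_ereal_sup => _ [[p q] [/= Cp Cq] <-].
by exists (p, q) => //; split; exact: CD.
Qed.

End LocalTypes.

Theorem theorem3p12 (R : realType) (L : language R) (T : theory L)
    (x y : seq (lsort L)) (phi : formula (x ++ y)) (delta : R)
    (M : structure L)
    (mu : probability (borel (local_type_space M phi)) R) :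
  countable_language L ->
  complete_theory T ->
  unit_valued T phi ->
  stable T phi delta ->
  models M T ->
  regular_measure mu ->
  exists (I : countType) (C : I -> set (local_type_space M phi)),
    [/\ trivIset [set: I] C,
        forall i, closed (C i),
        forall i, (local_diam (C i) <= (2 * delta)%:E)%E /\ (0 < mu (C i))%E
      & forall B : set (borel (local_type_space M phi)), measurable B ->
          mu B = (\esum_(i in [set: I]) (mu (C i) * localization mu (C i) B))%E].
Proof.
move=> _ _ phi01 st MT mu_reg.
have [gamma gd no_gap] := stable_gap st MT.
apply: (@regular_decomposition _ _ mu
  (fun C => local_diam C <= (2 * delta)%:E)%E) => //.
- exact: local_type_hausdorff.
- by move=> A B AB; apply: le_trans; exact: local_diam_sub.
move=> K K0.
(* Fragmentation is applied with tuples of [M] as approximate realizations, so only instability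
   inside [M] itself has to be excluded. *)
have [||||V [oV VK VP]] := @small_open_piece R (local_type_space M phi) (tuples M x)
  (tuples M y) (fun p b => local_val p b) (feval2 phi) _ _ _ _ gamma delta K
  gd no_gap K0.
- exact: local_val_continuous.
- by move=> p b; exact: local_val_unit MT.
- by move=> a b; exact: phi01.
- by move=> p bs e e0; exact: type_finitely_satisfiable.
by exists V; split=> //; exact: local_diam_le.
Qed.
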